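(* Let $f_0(x,y)=\frac34-\frac{d(x,y)}{4\pi}$ for $x,y\in\mathcal C$. For $x\in\mathcal C^n$ let $\mathbb P_{(x,f_0)}$ be the distribution of the random symmetric matrix $A\in\{0,1\}^{n\times n}$ with $A_{ii}=0$ and with independent entries $(A_{ij})_{i<j}$, where $A_{ij}$ is Bernoulli with parameter $f_0(x_i,x_j)$. Then there exist two positive numerical constants $C,C'$ such that for any $n\ge C'$ (with $n$ a multiple of $4$), $$\inf_{\hat x}\ \sup_{x^*\in\Pi_n}\ \mathbb P_{(x^*,f_0)}\left[\min_{Q\in\mathcal O}d_\infty(\hat x,Qx^* )\ge C\sqrt{\frac{\log n}{n}}\right]\ge\frac12,$$ where the infimum is over all $\sigma(A)$-measurable functions $\hat x$ with values in $\mathcal C^n$.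
   Context: $\mathcal C$ is the unit circle in $\mathbb R^2$, identified with unit complex numbers; $x\in\mathcal C$ has argument $\underline x\in[0,2\pi)$; $d(x,y)=|\underline x-\underline y|\wedge(2\pi-|\underline x-\underline y|)$ is the geodesic distance. For $x,y\in\mathcal C^n$, $d_\infty(x,y)=\max_{1\le i\le n}d(x_i,y_i)$. $\Pi_n=\{(e^{\iota2\pi\sigma(j)/n})_{1\le j\le n}:\sigma\text{ a permutation of }\{1,\dots,n\}\}$. $\mathcal O$ is the orthogonal group of $\mathbb R^2$, acting by $Qx=(Qx_1,\dots,Qx_n)$. *)

(* Defs.v *)
From HB Require Import structures.
From mathcomp Require Import all_boot all_order all_algebra perm lra.
From mathcomp Require Import all_classical all_reals all_analysis.

Set Implicit Arguments.
Unset Strict Implicit.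
Unset Printing Implicit Defensive.

Import Order.TTheory GRing.Theory Num.Theory.
Local Open Scope classical_set_scope.
Local Open Scope ring_scope.

Definition circle (R : realType) : set 'cV[R]_2 :=
  [set x | x 0 0 ^+ 2 + x 1 0 ^+ 2 = 1].

(* the unit complex number e^(it), seen in R^2 *)
Definition expi (R : realType) (t : R) : 'cV[R]_2 :=
  \col_k (if k == 0 then cos t else sin t).

(* meaningful for x on the circle only, see [argP] and [arg_expi] *)
Definition arg (R : realType) (x : 'cV[R]_2) : R :=
  xget 0 [set t : R | 0 <= t < 2 * pi /\ x = expi t].

Definition geod (R : realType) (x y : 'cV[R]_2) : R :=
  Num.min `|arg x - arg y| (2 * pi - `|arg x - arg y|).

(* The base value 0 of the maximum is harmless, since [geod] is nonnegative *)
Definition dinfty (R : realType) (n : nat) (x y : 'I_n -> 'cV[R]_2) : R :=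
  \big[Num.max/0]_(i < n) geod (x i) (y i).

(* The index j : 'I_n (resp. the value s j : 'I_n) stands for the element j.+1
   (resp. (s j).+1) of {1, ..., n} *)
Definition Pi_ (R : realType) (n : nat) : set ('I_n -> 'cV[R]_2) :=
  [set x | exists s : 'S_n,
     x = fun j => expi (2 * pi * (s j).+1%:R / n%:R)].

Definition orthogonal_group (R : realType) : set 'M[R]_2 :=
  [set Q | Q^T *m Q = 1%:M].

Definition act (R : realType) (n : nat) (Q : 'M[R]_2) (x : 'I_n -> 'cV[R]_2) :
  'I_n -> 'cV[R]_2 := fun i => Q *m x i.

(* min over Q of d_infty(xh, Qx): an infimum of real numbers, bounded below by 0
   and attained by compactness of the orthogonal group *)
Definition loss (R : realType) (n : nat) (xh x : 'I_n -> 'cV[R]_2) : R :=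
  inf [set dinfty xh (act Q x) | Q in @orthogonal_group R].

Definition f0 (R : realType) (x y : 'cV[R]_2) : R :=
  3 / 4 - geod x y / (4 * pi).

(* Law of the adjacency matrix (true = 1, false = 0), as a mass function on all
   boolean matrices: it is carried by the symmetric matrices with zero diagonal,
   and the entries above the diagonal are independent Bernoulli variables, see
   [graph_prob_entries] *)
Definition graph_pmf (R : realType) (n : nat) (x : 'I_n -> 'cV[R]_2)
    (f : 'cV[R]_2 -> 'cV[R]_2 -> R) (A : 'M[bool]_n) : R :=
  if (A^T == A) && [forall i, A i i == false] then
    \prod_(i < n) \prod_(j < n | (i < j)%N)
      bernoulli_pmf (f (x i) (x j)) (A i j)
  else 0.

Definition graph_prob (R : realType) (n : nat) (x : 'I_n -> 'cV[R]_2)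
    (f : 'cV[R]_2 -> 'cV[R]_2 -> R) (E : set 'M[bool]_n) : R :=
  \sum_(A : 'M[bool]_n | A \in E) graph_pmf x f A.

(* The sigma(A)-measurable functions are the functions of A, as A takes finitely
   many values *)
Definition estimators (R : realType) (n : nat) :
    set ('M[bool]_n -> 'I_n -> 'cV[R]_2) :=
  [set xh | forall A i, @circle R (xh A i)].

Arguments circle : clear implicits.
Arguments Pi_ : clear implicits.
Arguments orthogonal_group : clear implicits.
Arguments estimators : clear implicits.

Lemma circle_expi (R : realType) (t : R) : circle R (expi t).
Proof. by rewrite /circle /= !mxE /= cos2Dsin2. Qed.

Lemma argP (R : realType) (x : 'cV[R]_2) : circle R x ->
  0 <= arg x < 2 * pi /\ x = expi (arg x).
Proof.
move=> cx; rewrite /arg; case: xgetP => [t _ []//|noarg]; exfalso.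
rewrite /circle /= in cx.
have xE t : cos t = x 0 0 -> sin t = x 1 0 -> x = expi t.
  move=> ct st; apply/matrixP => i j; rewrite !mxE (ord1 j).
  case: i => -[|[|//]] lti /=; rewrite ?ct ?st; congr (x _ _);
  exact: val_inj.
have x01 : -1 <= x 0 0 <= 1.
  by rewrite -ler_norml -(@expr_le1 _ 2) // real_normK ?num_real // -cx
             lerDl sqr_ge0.
have [/andP[a0 api] aK] := acos_def x01.
have ss : sin (acos (x 0 0)) = `|x 1 0|.
  by rewrite sin_acos // -cx addrC addKr sqrtr_sqr.
have pi0 := pi_gt0 R.
have [x1|x1] := leP 0 (x 1 0).
  apply: (noarg (acos (x 0 0))); split; first by apply/andP; split => //; lra.
  by apply: xE => //; rewrite ss ger0_norm.
have a_gt0 : acos (x 0 0) != 0.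
  apply/eqP => aE; move: ss; rewrite aE sin0 => /esym/normr0_eq0 x10.
  by rewrite x10 ltxx in x1.
apply: (noarg (- acos (x 0 0) + pi *+ 2)); split.
  by rewrite mulr2n; apply/andP; split; lra.
apply: xE; first by rewrite cosD2pi cosN.
by rewrite sinD2pi sinN ss ltr0_norm // opprK.
Qed.

Lemma arg_expi (R : realType) (t : R) : 0 <= t < 2 * pi -> arg (expi t) = t.
Proof.
have pi0 := pi_gt0 R.
have cosE s : 0 <= s < 2 * pi -> cos s = 1 -> s = 0 :> R.
  move=> /andP[s0 s2] cs; have [sp|sp] := leP s pi.
    by apply: cos_inj; rewrite ?cos0 ?in_itv //= ?s0 ?lexx //= ltW.
  suff : - s + pi *+ 2 = 0 by rewrite mulr2n; lra.
  apply: cos_inj; rewrite ?cosD2pi ?cosN ?cos0 ?in_itv //= ?lexx ?(ltW pi0) //.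
  by rewrite mulr2n; apply/andP; split; lra.
move=> t02; have [/andP[a0 a2] /matrixP aE] := argP (circle_expi t).
set a := arg _ in a0 a2 aE *.
have ct : cos t = cos a by have := aE 0 0; rewrite !mxE.
have st : sin t = sin a by have := aE 1 0; rewrite !mxE.
case/andP: t02 => t0 t2.
have c1 : cos (t - a) = 1 by rewrite cosB ct st -!expr2 cos2Dsin2.
have [le|lt] := leP a t.
  suff : t - a = 0 by lra.
  by apply: cosE => //; apply/andP; split; lra.
suff : a - t = 0 by lra.
apply: cosE; last by rewrite -opprB cosN.
by apply/andP; split; lra.
Qed.

Lemma graph_prob_entries (R : realType) (n : nat) (x : 'I_n -> 'cV[R]_2)
    (f : 'cV[R]_2 -> 'cV[R]_2 -> R) (S : {set 'I_n * 'I_n})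
    (b : 'I_n * 'I_n -> bool) :
  (forall p, p \in S -> (p.1 < p.2)%N) ->
  graph_prob x f [set A : 'M[bool]_n | forall p, p \in S -> A p.1 p.2 = b p] =
  \prod_(p in S) bernoulli_pmf (f (x p.1) (x p.2)) (b p).
Proof.
move=> ltS; set E := [set A | _].
pose up (p : 'I_n * 'I_n) := (p.1 < p.2)%N.
pose Q p : pred bool := fun c => (p \in S) ==> (c == b p).
pose F p c := bernoulli_pmf (f (x p.1) (x p.2)) c.
have -> : \prod_(p in S) F p (b p) = \prod_(p | up p) \sum_(c | Q p c) F p c.
  rewrite [RHS](bigID (mem S)) /= [X in _ * X]big1 ?mulr1 => [|p /andP[_ pS]].
    apply: eq_big => [p|p pS].
      by case: (boolP (p \in S)) => [/ltS|]; rewrite /up ?andbT ?andbF.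
    by rewrite /Q pS /= big_pred1_eq.
  by rewrite /Q (negPf pS) /= big_bool /F /= addrC subrK.
rewrite (big_distr_big_dep false) /graph_prob.
pose sym (A : 'M[bool]_n) := (A^T == A) && [forall i, A i i == false].
rewrite (bigID sym) /= [X in _ + X]big1 ?addr0; last first.
  by move=> A /andP[_ nA]; rewrite /graph_pmf -/(sym A) (negPf nA).
pose h (g : {ffun 'I_n * 'I_n -> bool}) : 'M[bool]_n :=
  \matrix_(i, j) (if (i < j)%N then g (i, j)
                  else if (j < i)%N then g (j, i) else false).
pose k (A : 'M[bool]_n) : {ffun 'I_n * 'I_n -> bool} :=
  [ffun p => if up p then A p.1 p.2 else false].
rewrite (reindex_onto h k) /=.
  apply: eq_big => [g|g /andP[/andP[_ sg] _]].
    apply/idP/idP.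
      move=> /andP[/andP[gE _] /eqP <-]; rewrite inE /= in gE.
      apply/pfamilyP; split => [|p pup].
        apply/fintype.subsetP => p; rewrite inE /= ffunE.
        by rewrite unfold_in; case: ifP.
      rewrite ffunE (pup : up p) unfold_in; apply/implyP => pS; apply/eqP.
      exact: gE.
    move=> /pfamilyP[/fintype.subsetP supp gQ]; apply/andP; split; last first.
      apply/eqP/ffunP => p; rewrite ffunE mxE /up.
      case: ifP => pup; first by rewrite pup -surjective_pairing.
      case gp: (g p) => //; have := supp p.
      by rewrite /in_mem /= gp /up pup => /(_ isT).
    apply/andP; split.
      rewrite inE /= => p pS; rewrite mxE ltS // -surjective_pairing.
      have := gQ p (ltS p pS).
      by rewrite unfold_in /Q pS => /eqP.
    apply/andP; split; last by apply/forallP => i; rewrite mxE ltnn.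
    by apply/eqP/matrixP => i j; rewrite !mxE; case: ltngtP.
  rewrite /graph_pmf -/(sym _) sg pair_big_dep /=.
  by apply: eq_bigr => p pup; rewrite mxE pup -surjective_pairing.
move=> A /andP[_ /andP[/eqP symA /forallP diagA]].
apply/matrixP => i j; rewrite !mxE !ffunE /up /=.
case: (ltngtP i j) => // [_|ij]; first by rewrite -{1}symA mxE.
by rewrite (val_inj ij) (eqP (diagA j)).
Qed.

(* Main.v *)
(** Compare the labelling of the regular grid by the identity with the [m]
    labellings obtained by exchanging [k] and [k + m], for [k < m], where [m] is
    of order [sqrt (n ln n)].  Such an exchange perturbs [O(n)] Bernoulli
    parameters by [O(m / n)], so the likelihood ratio of each alternative to the
    identity has second moment [exp (O(m^2 / n))], a small power of [n].  This
    is below [m / 4], hence no test identifies the exchange with probability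
    above 1/2 uniformly.  An estimator with small loss would be such a test:
    when 4 divides [n], all these labellings put two common indices at the
    orthonormal vectors of arguments 0 and [pi / 2], which determine the
    orthogonal transformation up to the loss. *)

Require Import Defs.
From mathcomp Require Import all_boot all_order all_algebra perm ring lra zify.
From mathcomp Require Import all_classical all_reals all_analysis.

Import Order.TTheory GRing.Theory Num.Theory.
Local Open Scope classical_set_scope.
Local Open Scope ring_scope.

(** * Quadratic bounds on sine and cosine *)

Section Trigonometry.
Set Implicit Arguments.
Unset Strict Implicit.
Import numFieldNormedType.Exports.
Variable R : realType.
Implicit Types t : R.

Lemma sin_MVT t : 0 <= t -> exists2 c, 0 <= c <= t & sin t = cos c * t.
Proof.
move=> t0; have [|c] :=
  @MVT_segment R sin cos 0 t t0 (fun x _ => is_derive_sin x).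
  by apply: continuous_subspaceT => x; exact: continuous_sin.
by rewrite in_itv /= sin0 !subr0; exists c.
Qed.

Lemma sin_le_id t : 0 <= t -> sin t <= t.
Proof.
move=> t0; have [c _ ->] := sin_MVT t0.
by rewrite ler_piMl // cos_le1.
Qed.

Lemma cos_half t : cos t = 1 - 2 * sin (t / 2) ^+ 2.
Proof.
have {1}-> : t = (t / 2) *+ 2 by rewrite mulr2n -splitr.
by rewrite cos_mulr2n; have := cos2Dsin2 (t / 2); lra.
Qed.

Lemma cos_ge_quad t : 0 <= t <= pi -> 1 - t ^+ 2 / 2 <= cos t.
Proof.
move=> /andP[t0 tpi]; rewrite cos_half.
have s0 : 0 <= sin (t / 2) by apply: sin_ge0_pi; apply/andP; split; lra.
have s1 : sin (t / 2) <= t / 2 by apply: sin_le_id; lra.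
by nra.
Qed.

(** The intermediate point given by the mean value theorem is at most 1, where the quadratic bound
    makes the cosine at least 1/2. *)
Lemma sin_ge_half t : 0 <= t <= 1 -> t / 2 <= sin t.
Proof.
move=> /andP[t0 t1]; have [c /andP[c0 ct] ->] := sin_MVT t0.
have pi2 := pi_ge2 R.
have : 1 - c ^+ 2 / 2 <= cos c by apply: cos_ge_quad; apply/andP; split; lra.
by nra.
Qed.

Lemma cos_le_quad t : 0 <= t <= 2 -> cos t <= 1 - t ^+ 2 / 8.
Proof.
move=> t02; rewrite cos_half.
have : t / 2 / 2 <= sin (t / 2) by apply: sin_ge_half; lra.
by nra.
Qed.

End Trigonometry.

(** * Chords, geodesic distance and isometries of the plane *)

Section Plane.
Set Implicit Arguments.
Unset Strict Implicit.
Variable R : realType.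
Implicit Types (u v w : 'cV[R]_2) (Q : 'M[R]_2).

Definition sqnorm v : R := v 0 0 ^+ 2 + v 1 0 ^+ 2.

Lemma sqnormN v : sqnorm (- v) = sqnorm v.
Proof. by rewrite /sqnorm !mxE !sqrrN. Qed.

Lemma sqnormD_le u v : sqnorm (u + v) <= 2 * sqnorm u + 2 * sqnorm v.
Proof.
rewrite /sqnorm !mxE.
have := sqr_ge0 (u 0 0 - v 0 0); have := sqr_ge0 (u 1 0 - v 1 0); nra.
Qed.

Lemma sqnorm_orthogonal Q v :
  orthogonal_group R Q -> sqnorm (Q *m v) = sqnorm v.
Proof.
have sqnormE w : sqnorm w = (w^T *m w) 0 0.
  by rewrite mxE big_ord_recl big_ord1 !mxE /sqnorm !expr2; congr (_ + _ * _);
    congr (w _ _); apply: val_inj.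
by move=> QQ; rewrite !sqnormE trmx_mul mulmxA -(mulmxA v^T) QQ mulmx1.
Qed.

(** By linearity, [D *m expi t] combines the images of the two basis vectors with weights [cos t]
    and [sin t]; Cauchy-Schwarz in each coordinate bounds its squared norm by the sum of the two
    given ones. *)
Lemma sqnorm_mulmx_le D (d : R) t :
  sqnorm (D *m expi 0) <= d -> sqnorm (D *m expi (pi / 2)) <= d ->
  sqnorm (D *m expi t) <= 2 * d.
Proof.
rewrite /sqnorm !mxE !big_ord_recl !big_ord0 !mxE /=
  !(cos0, sin0, cos_pihalf, sin_pihalf).
rewrite !(mulr0, mulr1, addr0, add0r) => H0 H1; have cs := cos2Dsin2 t.
set a := D 0 _ in H0 *; set b := D 1 _ in H0 *.
set a' := D 0 _ in H1 *; set b' := D 1 _ in H1 *.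
set c := cos t in cs *; set s := sin t in cs *.
have CS (x y : R) : (x * c + y * s) ^+ 2 <= x ^+ 2 + y ^+ 2.
  rewrite -[leRHS]mulr1 -cs; have := sqr_ge0 (x * s - y * c); nra.
by have := CS a a'; have := CS b b'; lra.
Qed.

Lemma sqnorm_expiB (a b : R) : sqnorm (expi a - expi b) = 2 - 2 * cos (a - b).
Proof.
rewrite /sqnorm !mxE /= cosB.
by have := cos2Dsin2 a; have := cos2Dsin2 b; nra.
Qed.

Lemma arg_ge0_lt2pi (x : 'cV[R]_2) : 0 <= arg x < 2 * pi.
Proof.
rewrite /arg; case: xgetP => [t _ []//|_].
by rewrite lexx mulr_gt0 ?pi_gt0.
Qed.

Lemma geod_ge0_lepi u v : 0 <= geod u v <= pi.
Proof.
have /andP[u0 u1] := arg_ge0_lt2pi u; have /andP[v0 v1] := arg_ge0_lt2pi v.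
rewrite /geod; set a := `|_|.
have a0 : 0 <= a by rewrite normr_ge0.
have a1 : a < 2 * pi by rewrite ltr_norml; apply/andP; split; lra.
by case: (leP a (2 * pi - a)) => ?; apply/andP; split; lra.
Qed.

Lemma geodC u v : geod u v = geod v u.
Proof. by rewrite /geod distrC. Qed.

(** The minimum of a and 2 pi - a is 1-Lipschitz in a; the rest is the reverse triangle
    inequality. *)
Lemma geod_lipschitz u v w : `|geod u w - geod v w| <= `|arg u - arg v|.
Proof.
rewrite /geod; set a := `|arg u - arg w|; set b := `|arg v - arg w|.
have : `|a - b| <= `|arg u - arg v|.
  by apply: le_trans (ler_dist_dist _ _) _; rewrite opprB addrA subrK.
rewrite !ler_norml => /andP[h1 h2].
case: (leP a (2 * pi - a)) => ?; case: (leP b (2 * pi - b)) => ?;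
  by apply/andP; split; lra.
Qed.

(** Cosine is even and 2 pi-periodic, so it sees neither the absolute value nor the wrap-around in
    [geod]. *)
Lemma cos_geod u v : cos (geod u v) = cos (arg u - arg v).
Proof.
have cosn (t : R) : cos `|t| = cos t by case: (ger0P t) => // _; rewrite cosN.
rewrite /geod; set a := `|_|; case: (leP a (2 * pi - a)) => _.
  exact: cosn.
by rewrite addrC mulrC mulr_natr cosD2pi cosN cosn.
Qed.

Lemma chord_le_geod u v : circle R u -> circle R v ->
  sqnorm (u - v) <= geod u v ^+ 2.
Proof.
move=> /argP[_ uE] /argP[_ vE].
rewrite {1}uE {1}vE sqnorm_expiB -cos_geod.
by have := cos_ge_quad (geod_ge0_lepi u v); lra.
Qed.

Lemma circle_orthogonal Q v : orthogonal_group R Q -> circle R v ->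
  circle R (Q *m v).
Proof. exact: (fun QQ => etrans (sqnorm_orthogonal v QQ)). Qed.

(** Keeps the Bernoulli parameters away from 0 and 1, as the chi-square bounds require. *)
Lemma f0_bounds u v : 1 / 2 <= f0 u v <= 3 / 4.
Proof.
have /andP[g0 g1] := geod_ge0_lepi u v; have pi0 := pi_gt0 R.
have : 0 <= geod u v / (4 * pi) <= 1 / 4.
  by apply/andP; split; [apply: divr_ge0|rewrite ler_pdivrMr]; lra.
by rewrite /f0; lra.
Qed.

Lemma f0_lipschitz u u' v v' :
  `|f0 u v - f0 u' v'| <= (`|arg u - arg u'| + `|arg v - arg v'|) / (4 * pi).
Proof.
have pi0 := pi_gt0 R.
have -> : f0 u v - f0 u' v' = (geod u' v' - geod u v) / (4 * pi).
  by rewrite /f0; lra.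
rewrite normrM [X in _ * X]gtr0_norm ?invr_gt0 ?mulr_gt0 //.
rewrite ler_pM2r ?invr_gt0 ?mulr_gt0 // distrC.
have := geod_lipschitz u u' v; have := geod_lipschitz v v' u'.
rewrite (geodC v) (geodC v') => h1 h2.
by have := ler_distD (geod u' v) (geod u v) (geod u' v'); lra.
Qed.

Lemma exists_loss_lt n (xh x : 'I_n -> 'cV[R]_2) (d : R) : loss xh x < d ->
  exists2 Q, orthogonal_group R Q & forall i, geod (xh i) (Q *m x i) < d.
Proof.
rewrite /loss => ltd; have [|_ [Q QQ <-] lt] := inf_lt _ ltd.
  exists (dinfty xh (act 1%:M x)), 1%:M => //.
  by rewrite /orthogonal_group /= trmx1 mulmx1.
exists Q => // i; apply: le_lt_trans lt.
exact: (le_bigmax _ (fun i => geod (xh i) (Q *m x i))).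
Qed.

(* The two points [i0], [i1] fixed by both labellings pin the isometry down up
   to an error of order [d], so that a common estimate forces the labellings to
   be close everywhere. *)
Lemma common_estimate_close n (xh x y : 'I_n -> 'cV[R]_2) (d : R) i0 i1 i :
  (forall j, circle R (xh j)) -> (forall j, circle R (x j)) ->
  (forall j, circle R (y j)) ->
  x i0 = expi 0 -> y i0 = expi 0 ->
  x i1 = expi (pi / 2) -> y i1 = expi (pi / 2) ->
  loss xh x < d -> loss xh y < d -> sqnorm (x i - y i) <= 24 * d ^+ 2.
Proof.
move=> cxh cx cy x0 y0 x1 y1 /exists_loss_lt[Q QQ Hx] /exists_loss_lt[P PP Hy].
have close z U : orthogonal_group R U -> (forall j, circle R (z j)) ->
    (forall j, geod (xh j) (U *m z j) < d) ->
    forall j, sqnorm (xh j - U *m z j) <= d ^+ 2.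
  move=> UU cz Hz j; apply: le_trans (chord_le_geod _ _) _ => //.
    exact: circle_orthogonal.
  have /andP[g0 _] := geod_ge0_lepi (xh j) (U *m z j).
  by rewrite lerXn2r ?nnegrE ?(ltW (Hz j)) // (le_trans g0) // ltW.
have {}Hx := close _ _ QQ cx Hx; have {}Hy := close _ _ PP cy Hy.
have QP j : sqnorm (Q *m x j - P *m y j) <= 4 * d ^+ 2.
  have -> : Q *m x j - P *m y j = - (xh j - Q *m x j) + (xh j - P *m y j).
    by rewrite opprB addrA subrK.
  by apply: le_trans (sqnormD_le _ _) _; rewrite sqnormN;
    have := Hx j; have := Hy j; lra.
have D z : circle R z -> sqnorm ((Q - P) *m z) <= 8 * d ^+ 2.
  move=> /argP[_ ->]; rewrite (_ : 8 * _ = 2 * (4 * d ^+ 2)); last by lra.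
  apply: sqnorm_mulmx_le; rewrite mulmxBl.
    by have := QP i0; rewrite x0 y0.
  by have := QP i1; rewrite x1 y1.
rewrite -(sqnorm_orthogonal _ QQ).
have -> : Q *m (x i - y i) = (Q *m x i - P *m y i) - (Q - P) *m y i.
  rewrite mulmxBr mulmxBl opprB addrA; congr (_ - _).
  by rewrite subrK.
(* 24 = 2 * 4 + 2 * 8, from [QP] at [i] and from [D] at [y i]. *)
apply: le_trans (sqnormD_le _ _) _; rewrite sqnormN.
by have := QP i; have := D _ (cy i); lra.
Qed.

End Plane.

(** * Second moments of likelihood ratios and multiple testing *)

Section Likelihood.
Set Implicit Arguments.
Unset Strict Implicit.
Variable R : realType.

Definition simple_graph n (A : 'M[bool]_n) :=
  (A^T == A) && [forall i, A i i == false].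

(** Simple graphs correspond to boolean functions on the pairs i < j, by [h] and [k] below; the
    identity is then distributivity of the product over the sums. *)
Lemma sum_simple_graph_prod n (g : 'I_n -> 'I_n -> bool -> R) :
  \sum_(A : 'M[bool]_n | simple_graph A)
    \prod_(i < n) \prod_(j < n | (i < j)%N) g i j (A i j) =
  \prod_(i < n) \prod_(j < n | (i < j)%N) (g i j true + g i j false).
Proof.
pose up (p : 'I_n * 'I_n) := (p.1 < p.2)%N.
rewrite [RHS]pair_big_dep /=.
under [RHS]eq_bigr do rewrite -(big_bool _ (g _ _)).
rewrite (big_distr_big_dep false up (fun _ => xpredT) (fun p => g p.1 p.2)) /=.
pose h (u : {ffun 'I_n * 'I_n -> bool}) : 'M[bool]_n :=
  \matrix_(i, j) (if (i < j)%N then u (i, j)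
                  else if (j < i)%N then u (j, i) else false).
pose k (A : 'M[bool]_n) : {ffun 'I_n * 'I_n -> bool} :=
  [ffun p => if up p then A p.1 p.2 else false].
rewrite (reindex_onto h k) /=; last first.
  move=> A /andP[/eqP symA /forallP diagA].
  apply/matrixP => i j; rewrite !mxE !ffunE /up /=.
  case: (ltngtP i j) => // [_|ij]; first by rewrite -{1}symA mxE.
  by rewrite (val_inj ij) (eqP (diagA j)).
apply: eq_big => [u|u _]; last first.
  rewrite pair_big_dep /=; apply: eq_bigr => p pup.
  by rewrite mxE pup -surjective_pairing.
have -> : simple_graph (h u).
  apply/andP; split; last by apply/forallP => i; rewrite mxE ltnn.
  by apply/eqP/matrixP => i j; rewrite !mxE; case: ltngtP.
apply/eqP/pfamilyP => [<-|[/fintype.subsetP supp _]].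
  split=> //; apply/fintype.subsetP => p; rewrite inE /= ffunE unfold_in.
  by case: ifP.
apply/ffunP => p; rewrite ffunE mxE /up; case: ifP => pup.
  by rewrite pup -surjective_pairing.
case up_ : (u p) => //; have := supp p.
by rewrite /in_mem /= up_ /up pup => /(_ isT).
Qed.

Lemma sum_graph_pmf n (x : 'I_n -> 'cV[R]_2) f : \sum_A graph_pmf x f A = 1.
Proof.
rewrite (bigID (@simple_graph n)) /= [X in _ + X]big1 ?addr0; last first.
  by move=> A /negPf nA; rewrite /graph_pmf -/(simple_graph A) nA.
rewrite (eq_bigr (fun A : 'M[bool]_n => \prod_(i < n) \prod_(j < n | (i < j)%N)
    bernoulli_pmf (f (x i) (x j)) (A i j))); last first.
  by move=> A gA; rewrite /graph_pmf -/(simple_graph A) gA.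
rewrite (sum_simple_graph_prod (fun i j => bernoulli_pmf (f (x i) (x j)))).
by do 2!(rewrite big1 // => ? _); rewrite /bernoulli_pmf addrC subrK.
Qed.

Lemma graph_pmf_f0_gt0 n (x : 'I_n -> 'cV[R]_2) A :
  simple_graph A -> 0 < graph_pmf x (@f0 R) A.
Proof.
move=> gA; rewrite /graph_pmf -/(simple_graph A) gA.
apply: prodr_gt0 => i _; apply: prodr_gt0 => j _.
by rewrite /bernoulli_pmf; have := f0_bounds (x i) (x j); case: (A i j); lra.
Qed.

Lemma graph_pmf_notin n (x : 'I_n -> 'cV[R]_2) f A :
  ~~ simple_graph A -> graph_pmf x f A = 0.
Proof. by move=> /negPf nA; rewrite /graph_pmf -/(simple_graph A) nA. Qed.

(** The left side equals 1 + (q - p)^2 / (p (1 - p)), and p (1 - p) >= 3/16 on this range. *)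
Lemma bernoulli_chi2_le (p q : R) : 1 / 2 <= p <= 3 / 4 ->
  bernoulli_pmf q true ^+ 2 / bernoulli_pmf p true +
  bernoulli_pmf q false ^+ 2 / bernoulli_pmf p false <= 1 + 8 * (q - p) ^+ 2.
Proof.
move=> p01; rewrite /bernoulli_pmf.
have -> : q ^+ 2 / p + (1 - q) ^+ 2 / (1 - p) =
    1 + (q - p) ^+ 2 / (p * (1 - p)).
  by field; apply/andP; split; apply/eqP; lra.
rewrite lerD2l ler_pdivrMr; last by nra.
rewrite mulrAC -[leLHS]mul1r ler_wpM2r ?sqr_ge0 //; nra.
Qed.

(** [w] is the set of perturbed vertices. By independence the second moment is a product over pairs,
    each factor being at most exp (8 e^2 c^2) with c the number of endpoints in [w], counted per
    endpoint. Since c <= 2, c^2 <= 2 c, and c sums to 2 n #|w| over all ordered pairs. *)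
Lemma graph_chi2_le n (x y : 'I_n -> 'cV[R]_2) (e : R) (w : {pred 'I_n}) :
  (forall i j, `|f0 (y i) (y j) - f0 (x i) (x j)| <=
               e * ((i \in w)%:R + (j \in w)%:R)) ->
  \sum_A graph_pmf y (@f0 R) A ^+ 2 / graph_pmf x (@f0 R) A <=
  expR (32 * e ^+ 2 * n%:R * #|w|%:R).
Proof.
move=> H; pose c i j : R := (i \in w)%:R + (j \in w)%:R.
rewrite (bigID (@simple_graph n)) /= [X in _ + X]big1 ?addr0; last first.
  by move=> A nA; rewrite graph_pmf_notin // expr0n mul0r.
pose g i j b := bernoulli_pmf (f0 (y i) (y j)) b ^+ 2 /
  bernoulli_pmf (f0 (x i) (x j)) b.
rewrite (eq_bigr (fun A : 'M[bool]_n =>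
    \prod_(i < n) \prod_(j < n | (i < j)%N) g i j (A i j))); last first.
  move=> A gA; rewrite /graph_pmf -/(simple_graph A) gA.
  rewrite -prodrXl -prodf_div; apply: eq_bigr => i _.
  by rewrite -prodrXl -prodf_div.
rewrite sum_simple_graph_prod.
apply: (@le_trans _ _ (\prod_(i < n) \prod_(j < n | (i < j)%N)
    expR (16 * e ^+ 2 * c i j))).
  have b i j : 0 <= g i j true + g i j false <= expR (16 * e ^+ 2 * c i j).
    have px := f0_bounds (x i) (x j); apply/andP; split.
      by rewrite addr_ge0 // mulr_ge0 ?sqr_ge0 ?invr_ge0 // /bernoulli_pmf; lra.
    apply: le_trans (bernoulli_chi2_le _ px) _.
    apply: le_trans (expR_ge1Dx _); rewrite lerD2l.
    have := H i j; rewrite -/(c i j) => Hij.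
    have : (f0 (y i) (y j) - f0 (x i) (x j)) ^+ 2 <= e ^+ 2 * c i j ^+ 2.
      by rewrite -exprMn -real_normK ?num_real //
        lerXn2r ?nnegrE ?(le_trans _ Hij).
    have : c i j ^+ 2 <= 2 * c i j.
      by rewrite /c; case: (i \in w); case: (j \in w) => /=; lra.
    have := sqr_ge0 e; nra.
  apply: ler_prod => i _; apply/andP; split.
    by apply: prodr_ge0 => j _; case/andP: (b i j).
  by apply: ler_prod.
under eq_bigr do rewrite -expR_sum.
rewrite -expR_sum ler_expR.
apply: (@le_trans _ _ (\sum_(i < n) \sum_(j < n) 16 * e ^+ 2 * c i j)).
  apply: ler_sum => i _; rewrite [leRHS](bigID (fun j : 'I_n => (i < j)%N)) /=.
  rewrite lerDl; apply: sumr_ge0 => j _; apply: mulr_ge0; last exact: addr_ge0.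
  by apply: mulr_ge0; rewrite ?sqr_ge0.
under eq_bigr do rewrite -mulr_sumr big_split /= sumr_const card_ord.
rewrite -mulr_sumr big_split /= sumr_const card_ord sumrMnl.
have -> : \sum_(i < n) (i \in w)%:R = #|w|%:R :> R.
  by rewrite -sum1_card natr_sum [RHS]big_mkcond; apply: eq_bigr => i _;
    case: (i \in w).
by rewrite -mulr2n -mulr_natr -[X in X *+ 2]mulr_natr; lra.
Qed.

(* By AM-GM, [P k <= P k ^ 2 / (4 chi P0) + chi P0]; summing over the disjoint
   events [B k], the first terms contribute at most [N / 4] and the second ones
   at most [chi]. *)
Lemma exists_test_error_ge_half (T : finType) N (P0 : T -> R)
    (P : 'I_N -> T -> R) (B : 'I_N -> pred T) (chi : R) :
  (0 < N)%N -> 0 < chi -> 4 * chi <= N%:R ->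
  (forall A, 0 <= P0 A) -> \sum_A P0 A = 1 ->
  (forall k A, P0 A = 0 -> P k A = 0) ->
  (forall k l A, B k A -> B l A -> k = l) ->
  (forall k, \sum_A P k A ^+ 2 / P0 A <= chi) ->
  exists k, \sum_(A | B k A) P k A <= 1 / 2.
Proof.
move=> N0 chi0 chiN P0ge P0sum ac disj Hchi.
have amgm k A : P k A <= (4 * chi)^-1 * (P k A ^+ 2 / P0 A) + chi * P0 A.
  (* Where [P0] vanishes so does [P k], and the quotient is 0 by convention. *)
  have [p0|] := eqVneq (P0 A) 0.
    by rewrite (ac k) // p0 expr0n !(mul0r, mulr0) addr0.
  move=> pn0; have p0 : 0 < P0 A by rewrite lt_def pn0 P0ge.
  rewrite -subr_ge0.
  have -> : (4 * chi)^-1 * (P k A ^+ 2 / P0 A) + chi * P0 A - P k A =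
     (P k A - 2 * chi * P0 A) ^+ 2 / (4 * chi * P0 A).
    by field; rewrite pn0 gt_eqF.
  by rewrite divr_ge0 ?sqr_ge0 // !mulr_ge0 // ltW.
have tot : \sum_k \sum_(A | B k A) P k A <= N%:R / 2.
  apply: (@le_trans _ _ (
      \sum_(k < N) \sum_(A | B k A) (4 * chi)^-1 * (P k A ^+ 2 / P0 A) +
       \sum_(k < N) \sum_(A | B k A) chi * P0 A)).
    rewrite -big_split; apply: ler_sum => k _ /=.
    by rewrite -big_split; apply: ler_sum.
  have -> : N%:R / 2 = N%:R / 4 + N%:R / 4 :> R by lra.
  apply: lerD.
    have -> : N%:R / 4 = \sum_(k < N) 1 / 4 :> R.
      by rewrite sumr_const card_ord -mulr_natr; lra.
    apply: ler_sum => k _; apply: (@le_trans _ _ ((4 * chi)^-1 * chi)).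
      rewrite -mulr_sumr ler_wpM2l ?invr_ge0 ?mulr_ge0 ?(ltW chi0) //.
      apply: le_trans (Hchi k); rewrite [leRHS](bigID (B k)) /= lerDl.
      by apply: sumr_ge0 => A _; rewrite divr_ge0 ?sqr_ge0.
    by rewrite invfM -mulrA mulVf ?gt_eqF //; lra.
  apply: (@le_trans _ _ chi); last by lra.
  rewrite -[leRHS]mulr1 -P0sum mulr_sumr.
  under eq_bigr do rewrite big_mkcond /=.
  rewrite exchange_big /=; apply: ler_sum => A _.
  case: (pickP (B ^~ A)) => [k Bk|nB].
    rewrite (bigD1 k) //= Bk big1 ?addr0 // => l lk.
    by case: ifP => // /(disj k l A Bk) kl; rewrite kl eqxx in lk.
  by rewrite big1 ?mulr_ge0 ?(ltW chi0) // => k _; rewrite nB.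
apply: contrapT => /forallNP nle.
have : N%:R / 2 < \sum_k \sum_(A | B k A) P k A.
  have -> : N%:R / 2 = \sum_(k < N) 1 / 2 :> R.
    by rewrite sumr_const card_ord -mulr_natr; lra.
  apply: ltr_sum.
    by apply/hasP; exists (Ordinal N0); rewrite ?mem_index_enum.
  by move=> k _; rewrite ltNge; apply/negP.
by rewrite ltNge tot.
Qed.

End Likelihood.

(** * Exchanges of two points of the regular grid *)

Section Grid.
Set Implicit Arguments.
Unset Strict Implicit.
Variable R : realType.

Definition grid n (s : 'S_n) : 'I_n -> 'cV[R]_2 :=
  fun j => expi (2 * pi * (s j).+1%:R / n%:R).

(** The last grid point is excluded: its angle 2 pi is outside [0, 2 pi) and its argument is 0. *)
Lemma arg_expi_grid n k : (k.+1 < n)%N ->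
  arg (expi (2 * pi * k.+1%:R / n%:R)) = 2 * pi * k.+1%:R / n%:R :> R.
Proof.
move=> kn; have pi0 := pi_gt0 R.
have n0 : (0 : R) < n%:R by rewrite ltr0n (leq_trans _ kn).
apply: arg_expi; apply/andP; split; first by rewrite divr_ge0 ?mulr_ge0 ?pi_ge0.
by rewrite ltr_pdivrMr // ltr_pM2l ?mulr_gt0 // ltr_nat.
Qed.

Lemma arg_grid_tperm n (a b : 'I_n) m : (b = a + m :> nat)%N -> (b.+1 < n)%N ->
  forall i, `|arg (grid (tperm a b) i) - arg (grid 1 i)| <=
            2 * pi * m%:R / n%:R * (i \in pred2 a b)%:R.
Proof.
move=> bE bn i; have pi0 := pi_gt0 R.
have an : (a.+1 < n)%N by apply: leq_ltn_trans bn; rewrite bE ltnS leq_addr.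
have bR : 2 * pi * b.+1%:R / n%:R =
    2 * pi * a.+1%:R / n%:R + 2 * pi * m%:R / n%:R :> R.
  by rewrite -mulrDl -mulrDr -natrD bE.
have e0 : 0 <= 2 * pi * m%:R / n%:R :> R by rewrite divr_ge0 ?mulr_ge0 ?pi_ge0.
rewrite /grid perm1 !inE;
case: tpermP => [->|->|/eqP/negPf ia /eqP/negPf ib]; rewrite ?ia ?ib.
- by rewrite !arg_expi_grid // bR eqxx mulr1 addrAC subrr add0r ger0_norm.
- by rewrite !arg_expi_grid // bR eqxx orbT mulr1 opprD addrA subrr add0r normrN
    ger0_norm.
- by rewrite subrr normr0 mulr0.
Qed.

(** Each exchanged point turns by 2 pi m / n and [f0] has Lipschitz constant 1 / (4 pi), so the
    perturbation is e = m / (2 n) on a set of at most two vertices. *)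
Lemma graph_chi2_tperm_le n (a b : 'I_n) m :
  (b = a + m :> nat)%N -> (b.+1 < n)%N ->
  \sum_A graph_pmf (grid (tperm a b)) (@f0 R) A ^+ 2 /
    graph_pmf (grid 1) (@f0 R) A
  <= expR (16 * m%:R ^+ 2 / n%:R).
Proof.
move=> bE bn; have pi0 := pi_gt0 R.
have n0 : (0 : R) < n%:R by rewrite ltr0n (leq_trans _ bn).
apply: le_trans (@graph_chi2_le _ n _ _ (m%:R / (2 * n%:R)) (pred2 a b) _) _.
  move=> i j; apply: le_trans (f0_lipschitz _ _ _ _) _.
  rewrite ler_pdivrMr ?mulr_gt0 //.
  have := arg_grid_tperm bE bn i; have := arg_grid_tperm bE bn j.
  set u := (i \in _)%:R; set v := (j \in _)%:R => hj hi.
  have -> : m%:R / (2 * n%:R) * (u + v) * (4 * pi) =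
    2 * pi * m%:R / n%:R * u + 2 * pi * m%:R / n%:R * v.
    by field; rewrite gt_eqF.
  exact: lerD.
rewrite ler_expR.
have c2 : #|pred2 a b|%:R <= 2 :> R by rewrite ler_nat card2; case: (_ == _).
have -> : 16 * m%:R ^+ 2 / n%:R = 32 * (m%:R / (2 * n%:R)) ^+ 2 * n%:R * 2 :> R.
  by field; rewrite gt_eqF.
by rewrite ler_wpM2l // !mulr_ge0 ?sqr_ge0.
Qed.

Lemma grid_tperm_separated p m (a b a' b' : 'I_(4 * p)) xh (d : R) :
  (b = a + m :> nat)%N -> (b' = a' + m :> nat)%N ->
  (a < m)%N -> (a' < m)%N -> (2 * m < p)%N -> a <> a' ->
  (forall i, circle R (xh i)) ->
  loss xh (grid (tperm a b)) < d -> loss xh (grid (tperm a' b')) < d ->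
  m%:R ^+ 2 / (4 * p)%:R ^+ 2 <= 6 * d ^+ 2.
Proof.
move=> bE bE' am am' mp aa' cxh lt lt'.
have n0 : (0 : R) < (4 * p)%:R by rewrite ltr0n; lia.
(* Indices being shifted by one, these two sit at angles 2 pi and pi / 2; both lie beyond the
   exchanged indices, which are below 2 m < p. *)
have i0P : ((4 * p).-1 < 4 * p)%N by lia.
have i1P : (p.-1 < 4 * p)%N by lia.
have fixed (c e i : 'I_(4 * p)) : (c != i :> nat) -> (e != i :> nat) ->
    grid (tperm c e) i = expi (2 * pi * i.+1%:R / (4 * p)%:R) :> 'cV[R]_2.
  by move=> ci ei; rewrite /grid tpermD.
have at0 (c e : 'I_(4 * p)) : (c < 2 * m)%N -> (e < 2 * m)%N ->
    grid (tperm c e) (Ordinal i0P) = expi 0 :> 'cV[R]_2.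
  move=> c2 e2; rewrite fixed /=; [|lia|lia].
  rewrite prednK; last by lia.
  rewrite mulfK ?gt_eqF // -[2 * pi]add0r mulr_natl.
  by apply/matrixP => k l; rewrite !mxE cosD2pi sinD2pi.
have at1 (c e : 'I_(4 * p)) : (c < 2 * m)%N -> (e < 2 * m)%N ->
    grid (tperm c e) (Ordinal i1P) = expi (pi / 2) :> 'cV[R]_2.
  move=> c2 e2; rewrite fixed /=; [|lia|lia].
  rewrite prednK; last by lia.
  by congr expi; rewrite natrM; field; rewrite pnatr_eq0; lia.
have b2 : (b < 2 * m)%N by lia. have b2' : (b' < 2 * m)%N by lia.
have a2 : (a < 2 * m)%N by lia. have a2' : (a' < 2 * m)%N by lia.
have := common_estimate_close (x := grid (tperm a b))
  (y := grid (tperm a' b')) a cxh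
  (fun j => circle_expi _) (fun j => circle_expi _)
  (at0 _ _ a2 b2) (at0 _ _ a2' b2') (at1 _ _ a2 b2) (at1 _ _ a2' b2') lt lt'.
have aa : a' != a :> nat by apply/eqP => /val_inj /esym.
(* The second exchange fixes [a], as a < m <= b', while the first one turns it by the angle [t]. *)
rewrite (fixed a' b') //; last by lia.
set t : R := 2 * pi * m%:R / (4 * p)%:R.
have bR : 2 * pi * b.+1%:R / (4 * p)%:R =
    2 * pi * a.+1%:R / (4 * p)%:R + t :> R.
  by rewrite /t -mulrDl -mulrDr -natrD bE.
rewrite /grid tpermL sqnorm_expiB bR (addrC _ t) addrK => H.
have tE : t = 2 * pi * (m%:R / (4 * p)%:R) by rewrite /t !mulrA.
have pi2 := pi_ge2 R; have pi4 : pi < 4 :> R by have := pihalf_02 R; lra.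
have r0 : 0 <= m%:R / (4 * p)%:R :> R by rewrite divr_ge0.
have r8 : m%:R / (4 * p)%:R <= 1 / 8 :> R.
  by rewrite ler_pdivrMr // mul1r mulrC ler_pdivlMr // -natrM ler_nat; lia.
(* The squared chord 2 - 2 cos t is at least t^2 / 4 >= 4 (m / n)^2, and at most 24 d^2 by [H]. *)
have : cos t <= 1 - t ^+ 2 / 8.
  by apply: cos_le_quad; rewrite tE; apply/andP; split; nra.
have : 16 * (m%:R / (4 * p)%:R) ^+ 2 <= t ^+ 2.
  rewrite tE [leRHS]exprMn ler_wpM2r ?sqr_ge0 //; nra.
by rewrite -expr_div_n; lra.
Qed.

End Grid.

(** * Calibration of the exchange length and the minimax bound *)

Section MinimaxBound.
Set Implicit Arguments.
Unset Strict Implicit.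
Variable R : realType.

(** Take m = floor (sqrt (n ln n) / 8): then 16 m^2 / n <= ln n / 4, so the exponential is at most s
    = n^(1/4), whereas m is at least 8 s - 1. The threshold on n makes s >= 64. *)
Lemma exists_swap_length n : (64 ^ 4)%:R <= n%:R :> R ->
  exists m, [/\ (8 * m < n)%N, (0 < m)%N,
    4 * expR (16 * m%:R ^+ 2 / n%:R) <= m%:R :> R &
    ln n%:R * n%:R <= 256 * m%:R ^+ 2 :> R].
Proof.
move=> nbig.
have n0 : (0 : R) < n%:R by apply: lt_le_trans nbig; rewrite ltr0n.
set l : R := ln n%:R; set s : R := expR (l / 4).
have s4 : s ^+ 4 = n%:R by rewrite -expRM_natl mulrC divfK ?lnK ?posrE.
have s64 : 64 <= s.
  by rewrite -(@ler_pXn2r _ 4) ?nnegrE ?expR_ge0 // s4 -natrX.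
(* Otherwise exp (- l / 4) > 3/4, which forces s < 4/3. *)
have l1 : 1 <= l.
  rewrite leNgt; apply/negP => l1.
  have : s * expR (- (l / 4)) = 1 by rewrite -expRD subrr expR0.
  have := expR_ge1Dx (- (l / 4)); nra.
have ln_lt : l < n%:R.
  by rewrite -[ltRHS]lnK ?posrE //; have := expR_ge1Dx l; lra.
set u : R := Num.sqrt (n%:R * l) / 8.
have u0 : 0 <= u by rewrite divr_ge0 ?sqrtr_ge0.
have u2 : u ^+ 2 = n%:R * l / 64.
  by rewrite expr_div_n sqr_sqrtr ?mulr_ge0 ?(le_trans ler01 l1) //; lra.
have us : 8 * s <= u.
  rewrite -(@ler_pXn2r _ 2) ?nnegrE //; last by lra.
  have s2 : 4096 <= s ^+ 2 by nra.
  have : 4096 * s ^+ 2 <= n%:R by rewrite -s4; nra.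
  by rewrite u2; nra.
have /andP[mu um] := truncn_itv u0; set m := Num.truncn u in mu um.
have um' : u < m%:R + 1 by rewrite natr1.
have m0 : 0 <= m%:R :> R by [].
exists m; split.
- rewrite -(ltr_nat R) natrM -(@ltr_pXn2r _ 2) ?nnegrE ?mulr_ge0 //.
  by nra.
- by rewrite -(ltr_nat R); lra.
- have : expR (16 * m%:R ^+ 2 / n%:R) <= s.
    by rewrite ler_expR ler_pdivrMr //; nra.
  by lra.
- by nra.
Qed.

End MinimaxBound.

Theorem theorem5p1 (R : realType) :
  exists C C' : R, [/\ 0 < C, 0 < C' &
    forall n : nat, (4 %| n)%N -> C' <= n%:R ->
      ((1 / 2)%:E <=
       ereal_inf [set ereal_sup
           [set (graph_prob xstar (@f0 R)
                  [set A | (C * Num.sqrt (ln n%:R / n%:R)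
                            <= loss (xhat A) xstar)%R])%:E
           | xstar in Pi_ R n]
         | xhat in estimators R n])%E].
Proof.
exists (1 / 64), (64 ^ 4)%:R; split; [lra|by rewrite ltr0n|].
move=> n /dvdnP[p nE] nbig; rewrite mulnC in nE; subst n.
have [m [mn m0 chi_le mln]] := exists_swap_length nbig.
set n := (4 * p)%N in nbig mn chi_le mln *.
apply/ereal_infP => _ [xhat cxhat <-].
set d := 1 / 64 * _.
have n0 : (0 : R) < n%:R by rewrite ltr0n; lia.
(* The constant 1/64 works since n ln n <= 256 m^2 and 6 * 256 / 64^2 < 1; this contradicts the
   separation bound. *)
have d2 : 6 * d ^+ 2 < m%:R ^+ 2 / n%:R ^+ 2.
  have l0 : 0 < ln n%:R :> R.
    by apply: ln_gt0; apply: lt_le_trans nbig; rewrite ltr1n.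
  rewrite exprMn sqr_sqrtr ?divr_ge0 ?(ltW l0) // ltr_pdivlMr ?exprn_gt0 //.
  have -> : 6 * ((1 / 64) ^+ 2 * (ln n%:R / n%:R)) * n%:R ^+ 2 =
    6 * (1 / 64) ^+ 2 * (ln n%:R * n%:R) :> R by field; rewrite gt_eqF.
  have : 0 < ln n%:R * n%:R :> R by rewrite mulr_gt0.
  by lra.
have aP (k : 'I_m) : (k < n)%N by have := ltn_ord k; lia.
have bP (k : 'I_m) : (k + m < n)%N by have := ltn_ord k; lia.
pose s k := tperm (Ordinal (aP k)) (Ordinal (bP k)).
pose B k : pred 'M[bool]_n := fun A => loss (xhat A) (grid R (s k)) < d.
have [k Bk] : exists k,
    \sum_(A | B k A) graph_pmf (grid R (s k)) (@f0 R) A <= 1 / 2.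
  apply: (@exists_test_error_ge_half R _ m (graph_pmf (grid R 1) (@f0 R)) _ B
    (expR (16 * m%:R ^+ 2 / n%:R))) => //.
  - move=> A; case: (boolP (simple_graph A)) => gA; last first.
      by rewrite graph_pmf_notin.
    exact/ltW/graph_pmf_f0_gt0.
  - exact: sum_graph_pmf.
  - move=> k A; case: (boolP (simple_graph A)) => gA; last first.
      by rewrite !graph_pmf_notin.
    by have := graph_pmf_f0_gt0 (grid R 1) gA => /[swap] ->; rewrite ltxx.
  (* Disjointness: one estimate cannot be within [d] of two alternatives. *)
  - move=> k l A Bk Bl; apply: contrapT => kl.
    have : m%:R ^+ 2 / n%:R ^+ 2 <= 6 * d ^+ 2.
      apply: (@grid_tperm_separated R p m _ _ _ _ (xhat A) d
        _ _ _ _ _ _ _ Bk Bl) => //=.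
        by lia.
      by move=> /(congr1 val)/= /val_inj.
    by rewrite leNgt d2.
  - move=> k; apply: graph_chi2_tperm_le => //=.
    by have := ltn_ord k; lia.
(* The supremum is bounded below by its value at alternative [k], where the complement of [B k] has
   mass at least 1/2. *)
apply: (le_trans _ (ereal_sup_ubound _)); last first.
  by exists (grid R (s k)) => //; exists (s k).
rewrite lee_fin /graph_prob (eq_bigl (fun A => ~~ B k A)); last first.
  by move=> A; rewrite /B -leNgt; apply/idP/idP; rewrite inE.
have := sum_graph_pmf (grid R (s k)) (@f0 R); rewrite (bigID (B k)) /=.
by lra.
Qed.
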